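(* Let $(X,r)$ be a finite non-degenerate solution of the Yang--Baxter equation that is not a Lyubashenko solution. Then $(X,r)$ is simple if and only if there exist a finite skew left brace $B$ and an injective morphism of solutions $(X,r)\to(B,r_B)$ such that, identifying $X$ with its image in $B$: $B$ is additively generated by $X$; the ideal $V$ of $B$ generated by $\{x-y:x,y\in X\}$ is the smallest non-zero ideal of $B$ (non-zero and contained in every non-zero ideal); and $V$ acts transitively on $X$, i.e. $X$ is invariant under the maps $\sigma_a\lambda_b$ ($a,b\in V$) and the group $\{\sigma_a\lambda_b|_X:a,b\in V\}$ acts transitively on $X$.
   Context: A set-theoretic solution $(X,r)$: $X$ non-empty, $r\colon X\times X\to X\times X$ satisfying $(r\times\mathrm{id})(\mathrm{id}\times r)(r\times\mathrm{id})=(\mathrm{id}\times r)(r\times\mathrm{id})(\mathrm{id}\times r)$; write $r(x,y)=(\lambda_x(y),\rho_y(x))$; non-degenerate means $r$ bijective and all $\lambda_x,\rho_y$ bijective. A morphism $f\colon(X,r)\to(Y,s)$ is a map with $(f\times f)r=s(f\times f)$; $(X,r)$ with $|X|>1$ is simple if every surjective morphism $(X,r)\to(Y,s)$ is bijective or has $|Y|=1$. Lyubashenko: $\lambda_x=\lambda_y$ and $\rho_x=\rho_y$ for all $x,y\in X$. A skew left brace $(B,+,\circ)$: $(B,+)$, $(B,\circ)$ groups with $a\circ(b+c)=a\circ b-a+a\circ c$; $\lambda_a(b)=-a+a\circ b$, $\sigma_a(b)=-a+b+a$, $a^{-1}$ the $\circ$-inverse. An ideal is a normal subgroup $I$ of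 $(B,+)$ with $\lambda_a(I)\subseteq I$ for all $a\in B$ and $I$ normal in $(B,\circ)$. The associated solution is $r_B(a,b)=(\lambda_a(b),\lambda_a(b)^{-1}\circ a\circ b)$. *)

(* Defs.v *)
From mathcomp Require Import all_boot.
Set Implicit Arguments. Unset Strict Implicit. Unset Printing Implicit Defensive.

Section Solutions.
Variable X : Type.
Implicit Type r : X * X -> X * X.

Definition r12 r (t : X * X * X) : X * X * X :=
  let '(x, y, z) := t in let '(a, b) := r (x, y) in (a, b, z).
Definition r23 r (t : X * X * X) : X * X * X :=
  let '(x, y, z) := t in let '(b, c) := r (y, z) in (x, b, c).

Definition is_solution r : Prop :=
  forall t, r12 r (r23 r (r12 r t)) = r23 r (r12 r (r23 r t)).

Definition sol_lambda r (x y : X) : X := (r (x, y)).1.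
Definition sol_rho r (y x : X) : X := (r (x, y)).2.

Definition nondegenerate r : Prop :=
  bijective r /\ (forall x, bijective (sol_lambda r x))
              /\ (forall y, bijective (sol_rho r y)).

Definition lyubashenko r : Prop :=
  forall x y z, sol_lambda r x z = sol_lambda r y z /\ sol_rho r x z = sol_rho r y z.
End Solutions.

Definition sol_morphism (X Y : Type) (r : X * X -> X * X) (s : Y * Y -> Y * Y)
  (f : X -> Y) : Prop :=
  forall x y, (f (r (x, y)).1, f (r (x, y)).2) = s (f x, f y).

Definition simple_solution (X : finType) (r : X * X -> X * X) : Prop :=
  1 < #|X| /\
  forall (Y : Type) (s : Y * Y -> Y * Y), is_solution s ->
  forall f : X -> Y, sol_morphism r s f -> (forall y, exists x, f x = y) ->
    bijective f \/ (exists y0 : Y, forall y : Y, y = y0).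

Record skew_brace := SkewBrace {
  sb_car :> finType;
  sb_add : sb_car -> sb_car -> sb_car;
  sb_opp : sb_car -> sb_car;
  sb_zero : sb_car;
  sb_circ : sb_car -> sb_car -> sb_car;
  sb_inv : sb_car -> sb_car;
  sb_one : sb_car;
  sb_addA : forall a b c, sb_add a (sb_add b c) = sb_add (sb_add a b) c;
  sb_add0 : forall a, sb_add sb_zero a = a;
  sb_addN : forall a, sb_add (sb_opp a) a = sb_zero;
  sb_circA : forall a b c, sb_circ a (sb_circ b c) = sb_circ (sb_circ a b) c;
  sb_circ1 : forall a, sb_circ sb_one a = a;
  sb_circV : forall a, sb_circ (sb_inv a) a = sb_one;
  sb_compat : forall a b c,
    sb_circ a (sb_add b c) = sb_add (sb_add (sb_circ a b) (sb_opp a)) (sb_circ a c)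
}.

Section Brace.
Variable B : skew_brace.
Local Notation "a + b" := (sb_add a b).
Local Notation "- a" := (sb_opp a).
Local Notation "a 'o' b" := (sb_circ a b) (at level 40, left associativity).

Definition sb_lambda (a b : B) : B := - a + (a o b).
Definition sb_sigma (a b : B) : B := (- a + b) + a.

Definition brace_sol (t : B * B) : B * B :=
  let '(a, b) := t in
  (sb_lambda a b, (sb_inv (sb_lambda a b) o a) o b).

Definition is_ideal (I : B -> Prop) : Prop :=
  I (sb_zero B) /\ (forall a b, I a -> I b -> I (a + b)) /\ (forall a, I a -> I (- a)) /\
  (forall a i, I i -> I ((a + i) + - a)) /\
  (forall a i, I i -> I (sb_lambda a i)) /\
  I (sb_one B) /\ (forall a b, I a -> I b -> I (a o b)) /\ (forall a, I a -> I (sb_inv a)) /\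
  (forall a i, I i -> I ((a o i) o sb_inv a)).

Definition nonzero_set (I : B -> Prop) : Prop := exists b, I b /\ b <> sb_zero B.

Definition ideal_gen (S : B -> Prop) (b : B) : Prop :=
  forall I, is_ideal I -> (forall s, S s -> I s) -> I b.

Inductive add_gen (S : B -> Prop) : B -> Prop :=
  | add_gen_base s : S s -> add_gen S s
  | add_gen_zero : add_gen S (sb_zero B)
  | add_gen_add a b : add_gen S a -> add_gen S b -> add_gen S (a + b)
  | add_gen_opp a : add_gen S a -> add_gen S (- a).
End Brace.

(* Main.v *)
(* If [X] sits in [B] and [E] is a congruence on [X], the additive monoid
   generated by the differences [f x - f x'] with [E x x'] is an ideal acting
   trivially on [X / E]; the point is that [x |-> lam_x^-1 x] is a permutation
   of [X], which turns negatives of generators into circle inverses of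
   generators. If [E] is not the equality, this ideal contains [V], so
   transitivity of [V] makes [E] total.

   Conversely, every finite non-degenerate solution maps into a finite skew
   brace: on pairs of a permutation of [Sym X] and a permutation of [X], put
   [a o b = a * b^(twist (lam_of a))], where [lam_of a] is the image of the
   identity under the first component of [a] and [twist p] is the pair of the
   right translation by [p] and [p] itself. For a simple solution this map is
   injective, since otherwise it is constant and the solution is Lyubashenko.
   In a brace of minimal order containing [X], every non-zero ideal identifies
   two, hence all, points of [X], and so contains [V]; the [V]-orbits form a
   congruence with Lyubashenko quotient, so there is only one orbit. *)
Require Import Defs.
From mathcomp Require Import all_boot all_fingroup.
From Stdlib Require Import Classical ClassicalEpsilon.

Set Implicit Arguments. Unset Strict Implicit. Unset Printing Implicit Defensive.

Declare Scope brace_scope.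
Delimit Scope brace_scope with brace.
Notation "a + b" := (sb_add a b) : brace_scope.
Notation "- a" := (sb_opp a) : brace_scope.
Notation "a - b" := (sb_add a (sb_opp b)) : brace_scope.
Notation "a ** b" := (sb_circ a b)
  (at level 40, left associativity) : brace_scope.
Local Open Scope brace_scope.

(** On a finite type the inverse of [g] is an iterate of [g], so whatever [g] preserves is also
    preserved by its inverse. *)
Lemma finite_injective_closed (T : finType) (g : T -> T) (P : T -> Prop) :
  injective g -> (forall t, P t -> P (g t)) -> forall t, P (g t) -> P t.
Proof.
move=> g_inj gP t Pgt; rewrite -(finv_f g_inj t) /finv.
by elim: (fingraph.order g (g t)).-1 => //= n; apply: gP.
Qed.

(** * Skew braces *)

Section BraceTheory.
Variable B : skew_brace.
Implicit Types a b c : B.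
Local Notation "0" := (sb_zero B) : brace_scope.
Local Notation inv := (@sb_inv B).
Local Notation lam := (@sb_lambda B).
Local Notation sig := (@sb_sigma B).

Lemma addKl a : cancel (sb_add a) (sb_add (- a)).
Proof. by move=> b; rewrite sb_addA sb_addN sb_add0. Qed.

Lemma addI a : injective (sb_add a).
Proof. exact: can_inj (addKl a). Qed.

Lemma addr0 a : a + 0 = a.
Proof. by apply: (@addI (- a)); rewrite sb_addA sb_addN sb_add0. Qed.

Lemma addrN a : a - a = 0.
Proof. by apply: (@addI (- a)); rewrite addKl addr0. Qed.

Lemma opprK a : - (- a) = a.
Proof. by apply: (@addI (- a)); rewrite addrN sb_addN. Qed.

Lemma addNKl a : cancel (sb_add (- a)) (sb_add a).
Proof. by move=> b; rewrite -{1}(opprK a) addKl. Qed.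

Lemma addrK a b : a + b - b = a.
Proof. by rewrite -sb_addA addrN addr0. Qed.

Lemma addrNK a b : a - b + b = a.
Proof. by rewrite -sb_addA sb_addN addr0. Qed.

Lemma addIr a : injective (fun b => b + a).
Proof. by move=> b c /(congr1 (fun d => d - a)); rewrite !addrK. Qed.

Lemma opprD a b : - (a + b) = - b - a.
Proof. by apply: (@addI (a + b)); rewrite addrN sb_addA addrK addrN. Qed.

Lemma oppr0 : - (0 : B) = 0.
Proof. by rewrite -[LHS]sb_add0 addrN. Qed.

Lemma subr_eq0 a b : a - b = 0 -> a = b.
Proof. by move=> /(congr1 (fun c => c + b)); rewrite addrNK sb_add0. Qed.

Lemma circKl a : cancel (sb_circ a) (sb_circ (inv a)).
Proof. by move=> b; rewrite sb_circA sb_circV sb_circ1. Qed.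

Lemma circI a : injective (sb_circ a).
Proof. exact: can_inj (circKl a). Qed.

Lemma circr1 a : a ** sb_one B = a.
Proof. by apply: (@circI (inv a)); rewrite sb_circA sb_circV sb_circ1. Qed.

Lemma circrV a : a ** inv a = sb_one B.
Proof. by apply: (@circI (inv a)); rewrite circKl circr1. Qed.

Lemma invK a : inv (inv a) = a.
Proof. by apply: (@circI (inv a)); rewrite circrV sb_circV. Qed.

Lemma inv_inj : injective inv.
Proof. exact: can_inj invK. Qed.

Lemma circD a b : a ** b = a + lam a b.
Proof. by rewrite /sb_lambda addNKl. Qed.

Lemma lam_is_add a b c : lam a (b + c) = lam a b + lam a c.
Proof. by rewrite /sb_lambda sb_compat !sb_addA. Qed.

Lemma lam0r a : lam a 0 = 0.
Proof. by apply: (@addI (lam a 0)); rewrite -lam_is_add sb_add0 addr0. Qed.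

Lemma lamN a b : lam a (- b) = - lam a b.
Proof. by apply: (@addI (lam a b)); rewrite -lam_is_add !addrN lam0r. Qed.

Lemma sb_oneE : sb_one B = 0.
Proof.
have : lam (sb_one B) 0 = 0 by rewrite lam0r.
rewrite /sb_lambda sb_circ1 addr0 => /(congr1 (@sb_opp B)).
by rewrite opprK oppr0.
Qed.

Lemma lamM a b c : lam (a ** b) c = lam a (lam b c).
Proof.
apply: (@addI (a ** b)); rewrite -circD -sb_circA [b ** c]circD.
by rewrite (circD a (b + _)) lam_is_add sb_addA -circD.
Qed.

Lemma lam0 b : lam 0 b = b.
Proof. by rewrite -sb_oneE /sb_lambda sb_circ1 sb_oneE oppr0 sb_add0. Qed.

Lemma lamK a : cancel (lam a) (lam (inv a)).
Proof. by move=> b; rewrite -lamM sb_circV sb_oneE lam0. Qed.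

Lemma lamVK a : cancel (lam (inv a)) (lam a).
Proof. by move=> b; rewrite -lamM circrV sb_oneE lam0. Qed.

Lemma addE_circ a b : a + b = a ** lam (inv a) b.
Proof. by rewrite circD lamVK. Qed.

Lemma lam_inv a : lam a (inv a) = - a.
Proof. by rewrite /sb_lambda circrV sb_oneE addr0. Qed.

Lemma lamV a : lam (inv a) a = - inv a.
Proof. by rewrite -{2}(invK a) lam_inv. Qed.

Lemma sig_add a b c : sig (a + b) c = sig b (sig a c).
Proof. by rewrite /sb_sigma opprD !sb_addA. Qed.

Lemma sig_is_add a b c : sig a (b + c) = sig a b + sig a c.
Proof. by rewrite /sb_sigma !sb_addA -(sb_addA _ a (- a)) addrN addr0. Qed.

Lemma sig0 b : sig 0 b = b.
Proof. by rewrite /sb_sigma oppr0 sb_add0 addr0. Qed.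

Lemma sig0r a : sig a 0 = 0.
Proof. by rewrite /sb_sigma addr0 sb_addN. Qed.

Lemma sigN a b : sig a (- b) = - sig a b.
Proof. by rewrite /sb_sigma !opprD opprK sb_addA. Qed.

Lemma addC_sig a b : a + b = b + sig b a.
Proof. by rewrite /sb_sigma !sb_addA addrN sb_add0. Qed.

Lemma lam_sig a b c : lam a (sig b c) = sig (lam a b) (lam a c).
Proof. by rewrite /sb_sigma !lam_is_add lamN. Qed.

Lemma brace_sol1 a b : (brace_sol (a, b)).1 = lam a b.
Proof. by []. Qed.

(** After circle multiplication by [c = lam a b] on the left, both sides equal [a + c]: one as
    [a ** b], the other as [c + sig c a]. *)
Lemma brace_sol2 a b :
  (brace_sol (a, b)).2 = lam (inv (lam a b)) (sig (lam a b) a).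
Proof.
rewrite /=; set c := lam a b; apply: (@circI c).
rewrite -sb_circA sb_circA circrV sb_circ1 (circD c) lamVK (circD a) -/c.
exact: addC_sig.
Qed.

End BraceTheory.

(** * Congruences on a generating solution *)

Section Embedding.
Variables (X : finType) (r : X * X -> X * X) (B : skew_brace) (f : X -> B).
Hypothesis r_lam : forall x, bijective (sol_lambda r x).
Hypothesis f_inj : injective f.
Hypothesis f_morph : sol_morphism r (@brace_sol B) f.
Hypothesis f_gen : forall b, add_gen (fun c => exists x, f x = c) b.
Implicit Types (a b c : B) (x y z t : X).
Local Notation "0" := (sb_zero B) : brace_scope.
Local Notation inv := (@sb_inv B).
Local Notation lam := (@sb_lambda B).
Local Notation sig := (@sb_sigma B).

Lemma morph_lam x y : f (r (x, y)).1 = lam (f x) (f y).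
Proof. by have /(congr1 (@fst _ _)) := f_morph x y. Qed.

Lemma morph_rho x y : f (r (x, y)).2 =
  lam (inv (lam (f x) (f y))) (sig (lam (f x) (f y)) (f x)).
Proof. by have /(congr1 (@snd _ _)) := f_morph x y; rewrite brace_sol2. Qed.

(* Finiteness makes the negatives of generators superfluous. *)
Lemma add_ind (P : B -> Prop) :
  P 0 -> (forall b x, P b -> P (b + f x)) -> forall b, P b.
Proof.
move=> P0 PS b; rewrite -(sb_add0 b).
elim: {b}(f_gen b) (0) P0 => [_ [x <-] | | a b _ IHa _ IHb | b _ IHb] c Pc.
- exact: PS.
- by rewrite addr0.
- by rewrite sb_addA; apply/IHb/IHa.
- apply: (finite_injective_closed (@addIr _ b)) => [d|]; first exact: IHb.
  by rewrite addrNK.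
Qed.

(** To read [b + f x] as [b ** f y] one needs [lam b (f y) = f x], so surjectivity of [lam b] on the
    image of [f] is carried through the same induction. *)
Lemma circ_ind_aux (P : B -> Prop) :
  P 0 -> (forall b x, P b -> P (b ** f x)) ->
  forall b, P b /\ forall x, exists y, lam b (f y) = f x.
Proof.
move=> P0 PS; apply: add_ind => [|b x [Pb b_surj]].
  by split=> // x; exists x; rewrite lam0.
have [y yP] := b_surj x; have -> : b + f x = b ** f y by rewrite circD yP.
split=> [|z]; first exact: PS.
have [t <-] := b_surj z; have [g _ gK] := r_lam y.
by exists (g t); rewrite lamM -morph_lam [(r _).1]gK.
Qed.

Lemma circ_ind (P : B -> Prop) :
  P 0 -> (forall b x, P b -> P (b ** f x)) -> forall b, P b.
Proof. by move=> P0 PS b; case: (circ_ind_aux P0 PS b). Qed.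

(** A preimage under [lam (inv b)] is an image under [lam b]. The boolean equality lets [xchoose]
    define the action below. *)
Lemma lam_stable b x : exists y, f y == lam b (f x).
Proof.
have [//|//|_ /(_ x) [y yP]] := @circ_ind_aux (fun=> True) _ _ (inv b).
by exists y; rewrite -yP lamVK.
Qed.

Lemma sig_stable b x : exists y, f y == sig b (f x).
Proof.
elim/add_ind: b x => [|b z IHb] x; first by exists x; rewrite sig0.
have [y /eqP yP] := IHb x; rewrite sig_add -yP.
(* With [lam (f y) (f t) = f z], the second component of [r (y, t)] is sent by [lam (f z)] to
   [sig (f z) (f y)]. *)
have [t /eqP tP] := lam_stable (inv (f y)) z.
have fzE : lam (f y) (f t) = f z by rewrite tP lamVK.
have [u /eqP uP] := lam_stable (f z) (r (y, t)).2.
by exists u; rewrite uP morph_rho fzE lamVK.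
Qed.

Definition actL b x : X := xchoose (lam_stable b x).
Definition actS b x : X := xchoose (sig_stable b x).

Lemma f_actL b x : f (actL b x) = lam b (f x).
Proof. exact/eqP/(xchooseP (lam_stable b x)). Qed.

Lemma f_actS b x : f (actS b x) = sig b (f x).
Proof. exact/eqP/(xchooseP (sig_stable b x)). Qed.

Lemma actL0 x : actL 0 x = x.
Proof. by apply: f_inj; rewrite f_actL lam0. Qed.

Lemma actS0 x : actS 0 x = x.
Proof. by apply: f_inj; rewrite f_actS sig0. Qed.

Lemma actLM a b x : actL (a ** b) x = actL a (actL b x).
Proof. by apply: f_inj; rewrite !f_actL lamM. Qed.

Lemma actSD a b x : actS (a + b) x = actS b (actS a x).
Proof. by apply: f_inj; rewrite !f_actS sig_add. Qed.

Lemma actLK a : cancel (actL a) (actL (inv a)).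
Proof. by move=> x; rewrite -actLM sb_circV sb_oneE actL0. Qed.

Lemma actLVK a : cancel (actL (inv a)) (actL a).
Proof. by move=> x; rewrite -actLM circrV sb_oneE actL0. Qed.

Lemma actSK a : cancel (actS a) (actS (- a)).
Proof. by move=> x; rewrite -actSD addrN actS0. Qed.

Lemma actL_actS a b x : actL a (actS b x) = actS (lam a b) (actL a x).
Proof. by apply: f_inj; rewrite !(f_actL, f_actS) lam_sig. Qed.

Lemma solution_lam x y : (r (x, y)).1 = actL (f x) y.
Proof. by apply: f_inj; rewrite morph_lam f_actL. Qed.

Lemma solution_rho x y : (r (x, y)).2 =
  actL (inv (f (actL (f x) y))) (actS (f (actL (f x) y)) x).
Proof. by apply: f_inj; rewrite morph_rho !(f_actL, f_actS). Qed.

(** * Equivalence relations compatible with the solution *)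

Section Congruence.
Variable E : X -> X -> Prop.
Hypothesis E_refl : forall x, E x x.
Hypothesis E_sym : forall x y, E x y -> E y x.
Hypothesis E_trans : forall x y z, E x y -> E y z -> E x z.

(** If two permutations agree modulo [E], so do their inverses: evaluate both at [t'], the preimage
    of [y] under the second, and apply the inverse of the first. *)
Lemma actLV_congr x x' y :
  (forall b z z', E z z' -> E (actL b z) (actL b z')) ->
  (forall z, E (actL (f x) z) (actL (f x') z)) ->
  E (actL (inv (f x)) y) (actL (inv (f x')) y).
Proof.
move=> EL Exx'; set t' := actL (inv (f x')) y.
rewrite -[t'](actLK (f x)); apply: (EL); apply: E_sym.
by apply: E_trans (Exx' _) _; rewrite actLVK.
Qed.

(** Reduces the congruence property to the two actions and their dependence on the base point; it
    serves for the orbit relation of an ideal. *)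
Lemma solution_congr_of_act :
  (forall b x x', E x x' -> E (actL b x) (actL b x')) ->
  (forall b x x', E x x' -> E (actS b x) (actS b x')) ->
  (forall x x' y, E x x' -> E (actL (f x) y) (actL (f x') y)) ->
  (forall x x' y, E x x' -> E (actS (f x) y) (actS (f x') y)) ->
  forall x x' y y', E x x' -> E y y' ->
    E (r (x, y)).1 (r (x', y')).1 /\ E (r (x, y)).2 (r (x', y')).2.
Proof.
move=> EL ES EfL EfS x x' y y' Ex Ey; rewrite !solution_lam !solution_rho.
have Ez : E (actL (f x) y) (actL (f x') y').
  by apply: E_trans (EL _ _ _ Ey) _; apply: EfL.
split=> //; apply: (@E_trans _ (actL (inv (f (actL (f x) y)))
                              (actS (f (actL (f x') y')) x'))).
  by apply: EL; apply: E_trans (ES _ _ _ Ex) _; apply: EfS.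
by apply: actLV_congr => // z; apply: EfL.
Qed.

Hypothesis E_congr : forall x x' y y', E x x' -> E y y' ->
  E (r (x, y)).1 (r (x', y')).1 /\ E (r (x, y)).2 (r (x', y')).2.

Lemma actL_congr b x x' : E x x' -> E (actL b x) (actL b x').
Proof.
elim/circ_ind: b x x' => [|b z IHb] x x' Ex; first by rewrite !actL0.
rewrite !actLM -!solution_lam; apply: IHb.
by have [] := E_congr (E_refl z) Ex.
Qed.

Lemma actL_congrl x x' y : E x x' -> E (actL (f x) y) (actL (f x') y).
Proof. by move=> Ex; rewrite -!solution_lam; case: (E_congr Ex (E_refl y)). Qed.

Lemma actLV_congrl x x' y :
  E x x' -> E (actL (inv (f x)) y) (actL (inv (f x')) y).
Proof.
by move=> Ex; apply: actLV_congr => *; [apply: actL_congr | apply: actL_congrl].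
Qed.

Lemma actS_solution x y :
  actS (f y) x = actL (f y) (r (x, actL (inv (f x)) y)).2.
Proof. by rewrite solution_rho !actLVK. Qed.

Lemma actS_congr2 x x' y y' :
  E x x' -> E y y' -> E (actS (f y) x) (actS (f y') x').
Proof.
move=> Ex Ey; rewrite !actS_solution.
apply: E_trans (actL_congrl _ Ey); apply: actL_congr.
suff Et : E (actL (inv (f x)) y) (actL (inv (f x')) y').
  by have [] := E_congr Ex Et.
exact: E_trans (actL_congr _ Ey) (actLV_congrl _ Ex).
Qed.

Lemma actS_congr b x x' : E x x' -> E (actS b x) (actS b x').
Proof.
elim/add_ind: b x x' => [|b z IHb] x x' Ex; first by rewrite !actS0.
by rewrite !actSD; apply: actS_congr2 (E_refl z); apply: IHb.
Qed.

Let diag x := actL (inv (f x)) x.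

Lemma f_diag x : f (diag x) = - inv (f x).
Proof. by rewrite f_actL lamV. Qed.

Lemma diag_inj : injective diag.
Proof.
move=> x y /(congr1 f); rewrite !f_diag => /(congr1 (@sb_opp B)).
by rewrite !opprK => /(@inv_inj B)/f_inj.
Qed.

(** [diag] preserves [E], so its square on [X * X] is an injective self-map of a finite type
    preserving [E], and its inverse preserves [E] too. *)
Lemma diag_reflect x y : E (diag x) (diag y) -> E x y.
Proof.
pose g (p : X * X) := (diag p.1, diag p.2).
have g_inj : injective g by move=> [? ?] [? ?] [/diag_inj-> /diag_inj->].
apply: (@finite_injective_closed _ g (fun p => E p.1 p.2) g_inj _ (x, y)).
move=> [z t] /= Ezt.
exact: E_trans (actL_congr _ Ezt) (actLV_congrl _ Ezt).
Qed.

(* As [diag] is onto, [- f w] is the circle inverse of some [f u], so that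
   [f z - f z'] is [f z ** inv (f u)] with [u] equivalent to [z]. *)
Lemma actL_diff z z' x : E z z' -> E (actL (f z - f z') x) x.
Proof.
move=> Ez; pose w := actL (inv (f z)) z'; pose u := finv diag w.
have diag_u : diag u = w by apply: f_finv diag_inj _.
have Eu : E u z.
  by apply: diag_reflect; rewrite diag_u; apply/actL_congr/E_sym.
have -> : f z - f z' = f z ** inv (f u).
  by rewrite addE_circ lamN -f_actL -/w -diag_u f_diag opprK.
rewrite actLM -[X in E _ X](actLVK (f z) x).
by apply/actL_congr/actLV_congrl.
Qed.

(** * The ideal generated by the differences of congruent points *)

Inductive diff_gen : B -> Prop :=
  | diff_gen0 : diff_gen 0
  | diff_genS c x x' :
      diff_gen c -> E x x' -> diff_gen (c + (f x - f x')).

Lemma diff_gen_diff x x' : E x x' -> diff_gen (f x - f x').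
Proof. by move=> Ex; rewrite -[_ - _]sb_add0; apply: diff_genS diff_gen0 Ex. Qed.

Lemma diff_genD a b : diff_gen a -> diff_gen b -> diff_gen (a + b).
Proof.
move=> Na; elim=> [|c x x' _ IHc Ex]; first by rewrite addr0.
by rewrite sb_addA; apply: diff_genS.
Qed.

Lemma diff_genN a : diff_gen a -> diff_gen (- a).
Proof.
elim=> [|c x x' _ IHc Ex]; first by rewrite oppr0; apply: diff_gen0.
by rewrite !opprD opprK; apply: diff_genD IHc; apply/diff_gen_diff/E_sym.
Qed.

Lemma diff_gen_lam b a : diff_gen a -> diff_gen (lam b a).
Proof.
elim=> [|c x x' _ IHc Ex]; first by rewrite lam0r; apply: diff_gen0.
by rewrite !lam_is_add lamN -!f_actL; apply: diff_genS => //; apply: actL_congr.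
Qed.

Lemma diff_gen_sig b a : diff_gen a -> diff_gen (sig b a).
Proof.
elim=> [|c x x' _ IHc Ex]; first by rewrite sig0r; apply: diff_gen0.
by rewrite !sig_is_add sigN -!f_actS; apply: diff_genS => //; apply: actS_congr.
Qed.

Lemma diff_gen_conj b a : diff_gen a -> diff_gen (b + a - b).
Proof. by move=> /(diff_gen_sig (- b)); rewrite /sb_sigma opprK. Qed.

(** A sum [c + d] is [c ** lam (inv c) d], and [lam (inv c)] turns a difference of congruent points
    into another one, to which [actL_diff] applies. *)
Lemma actL_diff_gen a x : diff_gen a -> E (actL a x) x.
Proof.
move=> Na; elim: Na x => [|c z z' _ IHc Ez] x; first by rewrite actL0.
rewrite addE_circ lam_is_add lamN -!f_actL actLM; apply: E_trans (IHc _) _.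
by apply/actL_diff/actL_congr.
Qed.

Lemma actS_diff_gen a x : diff_gen a -> E (actS a x) x.
Proof.
move=> Na; elim: Na x => [|c z z' _ IHc Ez] x; first by rewrite actS0.
rewrite actSD; apply: E_trans (IHc x); rewrite actSD.
rewrite -[X in E _ X](actSK (f z')).
by apply/actS_congr/actS_congr2.
Qed.

(** For a generator [b = f x] this is a difference of congruent points; a sum contributes conjugates
    of such differences. Normality in the circle group rests on it. *)
Lemma diff_gen_lam_sub a b : diff_gen a -> diff_gen (lam a b - b).
Proof.
move=> Na; elim/add_ind: b => [|b x IHb].
  by rewrite lam0r addrN; apply: diff_gen0.
have -> : lam a (b + f x) - (b + f x) =
          (lam a b - b) + (b + (f (actL a x) - f x) - b).
  by rewrite lam_is_add opprD f_actL !sb_addA addrNK.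
by apply/(diff_genD IHb)/diff_gen_conj/diff_gen_diff/actL_diff_gen.
Qed.

Lemma diff_gen_ideal : is_ideal diff_gen.
Proof.
split; first exact: diff_gen0.
split; first exact: diff_genD.
split; first exact: diff_genN.
split; first exact: diff_gen_conj.
split; first exact: diff_gen_lam.
split; first by rewrite sb_oneE; apply: diff_gen0.
split=> [a b Na Nb|]; first by rewrite circD; apply/(diff_genD Na)/diff_gen_lam.
split=> [a Na|b a Na].
  by rewrite -[inv a]opprK -lamV; apply/diff_genN/diff_gen_lam.
(* The final [- b] is [lam b (inv b)], split off from [a ** inv b = a + (lam a (inv b) - inv b) +
   inv b]. *)
have -> : (b ** a) ** inv b = b + lam b (a + (lam a (inv b) - inv b)) - b.
  rewrite -sb_circA circD (circD a) [a + (_ - _)]sb_addA.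
  by rewrite (lam_is_add b (a + _)) lamN lam_inv opprK sb_addA addrK.
by apply/diff_gen_conj/diff_gen_lam/(diff_genD Na)/diff_gen_lam_sub.
Qed.

End Congruence.
End Embedding.

(** * Ideals, quotients and simplicity *)

Definition decide (P : Prop) : bool := excluded_middle_informative P.

Lemma decideP (P : Prop) : reflect P (decide P).
Proof. by rewrite /decide; case: excluded_middle_informative; constructor. Qed.

(** The quotient is the subtype of chosen representatives, the fixed points of [c]; it must be a
    [finType] to carry a skew brace. By reflexivity [pick] never fails, so the default of [odflt] is
    not reached. *)
Lemma finite_quotient (T : finType) (E : T -> T -> Prop) :
  (forall x, E x x) -> (forall x y, E x y -> E y x) ->
  (forall x y z, E x y -> E y z -> E x z) ->
  exists (Q : finType) (p : T -> Q) (s : Q -> T),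
    cancel s p /\ forall x y, p x = p y <-> E x y.
Proof.
move=> E_refl E_sym E_trans.
pose e x y := decide (E x y).
pose c x := odflt x [pick y | e x y].
have Ec x : E x (c x).
  rewrite /c; case: pickP => [y /decideP //|_]; exact: E_refl.
have cE x y : E x y -> c x = c y.
  move=> Exy; rewrite /c (@eq_pick _ (fun z => e x z) (fun z => e y z)).
    case: pickP => // /(_ y) /decideP; case; exact: E_refl.
  move=> z; apply/decideP/decideP => Ez; first exact: E_trans (E_sym _ _ Exy) Ez.
  exact: E_trans Exy Ez.
have cc x : c (c x) == c x by apply/eqP/esym/cE.
exists {x | c x == x}, (fun x => exist _ (c x) (cc x)), sval; split.
  by move=> [x xP]; apply: val_inj; apply/eqP.
move=> x y; split=> [[cxy]|/cE cxy]; last exact: val_inj.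
by apply: E_trans (Ec x) _; rewrite cxy; apply: E_sym.
Qed.

Section IdealTheory.
Variables (B : skew_brace) (I : B -> Prop).
Hypothesis idealI : is_ideal I.
Implicit Types a b c : B.
Local Notation "0" := (sb_zero B) : brace_scope.
Local Notation inv := (@sb_inv B).
Local Notation lam := (@sb_lambda B).
Local Notation sig := (@sb_sigma B).

Lemma ideal0 : I 0.
Proof. by have [] := idealI. Qed.

Lemma idealD a b : I a -> I b -> I (a + b).
Proof. by have [_ [+ _]] := idealI; apply. Qed.

Lemma idealN a : I a -> I (- a).
Proof. by have [_ [_ [+ _]]] := idealI; apply. Qed.

Lemma ideal_conj b a : I a -> I (b + a - b).
Proof. by have [_ [_ [_ [+ _]]]] := idealI; apply. Qed.

Lemma ideal_lam b a : I a -> I (lam b a).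
Proof. by have [_ [_ [_ [_ [+ _]]]]] := idealI; apply. Qed.

Lemma idealM a b : I a -> I b -> I (a ** b).
Proof. by have [_ [_ [_ [_ [_ [_ [+ _]]]]]]] := idealI; apply. Qed.

Lemma idealV a : I a -> I (inv a).
Proof. by have [_ [_ [_ [_ [_ [_ [_ [+ _]]]]]]]] := idealI; apply. Qed.

Lemma ideal_circ_conj b a : I a -> I (b ** a ** inv b).
Proof. by have [_ [_ [_ [_ [_ [_ [_ [_ +]]]]]]]] := idealI; apply. Qed.

Lemma ideal_sig b a : I a -> I (sig b a).
Proof. by move=> /(ideal_conj (- b)); rewrite opprK. Qed.

Lemma ideal_subC a b : I (a - b) -> I (- b + a).
Proof. by move=> /(ideal_sig b); rewrite /sb_sigma -!sb_addA sb_addN addr0. Qed.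

(** Circle normality gives [a ** b = b ** a'] with [a'] in [I], that is,
    [a + lam a b = b + lam b a']. *)
Lemma ideal_lam_sub a b : I a -> I (lam a b - b).
Proof.
move=> Ia; pose a' := (inv b ** a) ** b.
have Ia' : I a' by have := ideal_circ_conj (inv b) Ia; rewrite invK.
have -> : lam a b - b = - a + (b + lam b a' - b).
  by rewrite -circD /a' !sb_circA circrV sb_circ1 circD !sb_addA sb_addN sb_add0.
by apply: idealD; [apply: idealN | apply/ideal_conj/ideal_lam].
Qed.

(** Additive and circle cosets of an ideal coincide, because [b + u = b ** lam (inv b) u]. *)
Lemma ideal_circ_factor a b : I (a - b) -> exists2 v, I v & a = b ** v.
Proof.
move=> Iab; exists (lam (inv b) (- b + a)); first exact/ideal_lam/ideal_subC.
by rewrite -addE_circ addNKl.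
Qed.

Lemma ideal_sub_sym a b : I (a - b) -> I (b - a).
Proof. by move=> /idealN; rewrite opprD opprK. Qed.

Lemma ideal_sub_trans a b c : I (a - b) -> I (b - c) -> I (a - c).
Proof. by move=> Iab Ibc; have := idealD Iab Ibc; rewrite sb_addA addrNK. Qed.

Lemma ideal_congrD a a' b b' : I (a - a') -> I (b - b') -> I (a + b - (a' + b')).
Proof.
move=> Ia Ib; have -> : a + b - (a' + b') = (a + (b - b') - a) + (a - a').
  by rewrite opprD !sb_addA addrNK.
exact/idealD/Ia/ideal_conj.
Qed.

Lemma ideal_congrM a a' b b' :
  I (a - a') -> I (b - b') -> I (a ** b - a' ** b').
Proof.
move=> Ia Ib; rewrite !circD; apply: (ideal_congrD Ia).
apply: (@ideal_sub_trans _ (lam a b')).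
  by rewrite -lamN -lam_is_add; apply: ideal_lam.
have [v Iv ->] := ideal_circ_factor Ia.
by rewrite lamM -lamN -lam_is_add; apply/ideal_lam/ideal_lam_sub.
Qed.

(** The operations are computed on representatives; each axiom descends after every [u] is rewritten
    as [p (s u)]. *)
Lemma quotient_brace : exists (Q : skew_brace) (p : B -> Q),
  [/\ forall q, exists b, p b = q,
      {morph p : a b / a + b}, {morph p : a b / a ** b} &
      forall a b, p a = p b <-> I (a - b)].
Proof.
have [|||Q [p [s [sK pE]]]] := @finite_quotient B (fun a b => I (a - b)).
- by move=> a; rewrite addrN; apply: ideal0.
- exact: ideal_sub_sym.
- exact: ideal_sub_trans.
have IsK a : I (s (p a) - a) by apply/pE; rewrite sK.
pose add u v := p (s u + s v); pose circ u v := p (s u ** s v).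
pose opp u := p (- s u); pose sinv u := p (inv (s u)).
have pD a b : p (a + b) = add (p a) (p b).
  by apply/pE/ideal_sub_sym/ideal_congrD.
have pM a b : p (a ** b) = circ (p a) (p b).
  by apply/pE/ideal_sub_sym/ideal_congrM.
have addA u v w : add u (add v w) = add (add u v) w.
  by rewrite -(sK u) -(sK v) -(sK w) -!pD sb_addA.
have add0 u : add (p 0) u = u by rewrite -(sK u) -pD sb_add0.
have addN u : add (opp u) u = p 0 by rewrite -{2}(sK u) -pD sb_addN.
have circA u v w : circ u (circ v w) = circ (circ u v) w.
  by rewrite -(sK u) -(sK v) -(sK w) -!pM sb_circA.
have circ1 u : circ (p (sb_one B)) u = u by rewrite -(sK u) -pM sb_circ1.
have circV u : circ (sinv u) u = p (sb_one B).
  by rewrite -{2}(sK u) -pM sb_circV.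
have compat u v w :
    circ u (add v w) = add (add (circ u v) (opp u)) (circ u w).
  rewrite /opp -(sK v) -(sK w) -{1 2 4}(sK u).
  by rewrite -(pD (s v)) -!pM -!pD sb_compat.
exists (SkewBrace addA add0 addN circA circ1 circV compat), p; split=> //.
by move=> q; exists (s q).
Qed.

End IdealTheory.

Lemma ideal_gen_ideal (B : skew_brace) (S : B -> Prop) :
  is_ideal (ideal_gen S).
Proof.
split=> [I J _|]; first exact: ideal0.
split=> [a b Ia Ib I J SI|].
  by apply: (idealD J); [apply: Ia | apply: Ib].
split=> [a Ia I J SI|]; first by apply: (idealN J); apply: Ia.
split=> [a b Ib I J SI|]; first by apply: (ideal_conj J); apply: Ib.
split=> [a b Ib I J SI|]; first by apply: (ideal_lam J); apply: Ib.
split=> [I J SI|]; first by rewrite sb_oneE; apply: ideal0.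
split=> [a b Ia Ib I J SI|].
  by apply: (idealM J); [apply: Ia | apply: Ib].
split=> [a Ia I J SI|a b Ib I J SI]; first by apply: (idealV J); apply: Ia.
by apply: (ideal_circ_conj J); apply: Ib.
Qed.

Lemma ideal_zero (B : skew_brace) : is_ideal (fun b : B => b = sb_zero B).
Proof.
split=> //; split=> [a b -> ->|]; first exact: sb_add0.
split=> [a ->|]; first exact: oppr0.
split=> [a b ->|]; first by rewrite addr0 addrN.
split=> [a b ->|]; first exact: lam0r.
split; first exact: sb_oneE.
split=> [a b -> ->|]; first by rewrite -{1}sb_oneE sb_circ1.
rewrite -sb_oneE; split=> [a ->|a b ->]; last by rewrite circr1 circrV.
by rewrite -[LHS]circr1 sb_circV.
Qed.

Section Morphism.
Variables (B Q : skew_brace) (p : B -> Q).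
Hypothesis pD : {morph p : a b / a + b}.
Hypothesis pM : {morph p : a b / a ** b}.

Lemma brace_morph0 : p (sb_zero B) = sb_zero Q.
Proof. by apply: (@addI _ (p (sb_zero B))); rewrite -pD sb_add0 addr0. Qed.

Lemma brace_morphN a : p (- a) = - p a.
Proof. by apply: (@addI _ (p a)); rewrite -pD !addrN brace_morph0. Qed.

Lemma brace_morph_lam a b : p (sb_lambda a b) = sb_lambda (p a) (p b).
Proof. by rewrite /sb_lambda pD brace_morphN pM. Qed.

Lemma brace_morphV a : p (sb_inv a) = sb_inv (p a).
Proof. by apply: (@circI _ (p a)); rewrite -pM !circrV !sb_oneE brace_morph0. Qed.

Lemma brace_sol_morph : sol_morphism (@brace_sol B) (@brace_sol Q) p.
Proof. by move=> a b; rewrite /= !pM brace_morphV brace_morph_lam. Qed.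

End Morphism.

(** * Simplicity in terms of congruences *)

Lemma simple_congruence (X : finType) (r : X * X -> X * X)
    (E : X -> X -> Prop) :
  is_solution r -> simple_solution r ->
  (forall x, E x x) -> (forall x y, E x y -> E y x) ->
  (forall x y z, E x y -> E y z -> E x z) ->
  (forall x x' y y', E x x' -> E y y' ->
    E (r (x, y)).1 (r (x', y')).1 /\ E (r (x, y)).2 (r (x', y')).2) ->
  (forall x y, E x y -> x = y) \/ (forall x y, E x y).
Proof.
move=> sol_r [_ simple_r] E_refl E_sym E_trans E_congr.
have [Q [p [s [sK pE]]]] := finite_quotient E_refl E_sym E_trans.
(* The solution induced on the quotient; its braid relation is the image of that of [r] under [pp],
   which is onto. *)
pose q (u : Q * Q) := (p (r (s u.1, s u.2)).1, p (r (s u.1, s u.2)).2).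
have p_morph : sol_morphism r q p.
  move=> x y; rewrite /q /=; have Es z : E z (s (p z)) by apply/pE; rewrite sK.
  by have [/pE -> /pE ->] := E_congr _ _ _ _ (Es x) (Es y).
clearbody q; pose pp (t : X * X * X) := (p t.1.1, p t.1.2, p t.2).
have pp12 t : r12 q (pp t) = pp (r12 r t).
  case: t => [[x y] z]; rewrite /r12 /pp /= -p_morph.
  by case: (r _).
have pp23 t : r23 q (pp t) = pp (r23 r t).
  case: t => [[x y] z]; rewrite /r23 /pp /= -p_morph.
  by case: (r _).
have sol_q : is_solution q.
  move=> [[u v] w]; rewrite -(sK u) -(sK v) -(sK w).
  rewrite -[(_, _, _)]/(pp (s u, s v, s w)).
  by rewrite !(pp12, pp23) sol_r.
have [u|p_bij|[u uP]] := simple_r _ _ sol_q _ p_morph.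
- by exists (s u).
- by left=> x y /pE; apply: bij_inj.
by right=> x y; apply/pE; rewrite (uP (p x)) (uP (p y)).
Qed.

Lemma morphism_congr (X Y : Type) (r : X * X -> X * X) (s : Y * Y -> Y * Y)
    (g : X -> Y) (x x' y y' : X) :
  sol_morphism r s g -> g x = g x' -> g y = g y' ->
  g (r (x, y)).1 = g (r (x', y')).1 /\ g (r (x, y)).2 = g (r (x', y')).2.
Proof.
by move=> g_morph gx gy; have := g_morph x y; rewrite gx gy -g_morph => -[].
Qed.

Lemma simple_morphism (X : finType) (Y : Type) (r : X * X -> X * X)
    (s : Y * Y -> Y * Y) (g : X -> Y) :
  is_solution r -> simple_solution r -> sol_morphism r s g ->
  injective g \/ (forall x y, g x = g y).
Proof.
move=> sol_r simple_r g_morph.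
apply: (simple_congruence (E := fun x y => g x = g y) sol_r simple_r) => //.
  by move=> x y z -> ->.
by move=> x x' y y'; apply: (morphism_congr g_morph).
Qed.

Lemma simple_of_smallest_ideal (X : finType) (r : X * X -> X * X)
    (B : skew_brace) (f : X -> B) :
  nondegenerate r -> injective f -> sol_morphism r (@brace_sol B) f ->
  (forall b, add_gen (fun c => exists x, f x = c) b) ->
  let V := ideal_gen (fun c => exists x y, c = f x - f y) in
  nonzero_set V ->
  (forall I, is_ideal I -> nonzero_set I -> forall b, V b -> I b) ->
  (forall x y, exists a b,
    V a /\ V b /\ sb_sigma a (sb_lambda b (f x)) = f y) ->
  simple_solution r.
Proof.
move=> [_ [r_lam _]] f_inj f_morph f_gen V [v [Vv v_neq0]] V_min V_trans.
split=> [|Y s _ g g_morph g_surj].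
  (* With at most one point all generating differences vanish, so [V] lies in the zero ideal. *)
  rewrite ltnNge; apply/negP => /card_le1P X_le1; apply: v_neq0.
  apply: (Vv _ (ideal_zero B)) => _ [x [y ->]].
  by have := X_le1 x isT y; rewrite !inE => /esym/eqP->; rewrite addrN.
case: (classic (injective g)) => [g_inj|g_ninj].
  left; have g_surj' y : {x | g x = y}.
    exact: constructive_indefinite_description.
  exists (fun y => sval (g_surj' y)) => [x|y]; last by case: g_surj'.
  by apply: g_inj; case: g_surj'.
right; pose E x y := g x = g y.
have E_congr x x' y y' : E x x' -> E y y' ->
    E (r (x, y)).1 (r (x', y')).1 /\ E (r (x, y)).2 (r (x', y')).2.
  exact: (morphism_congr g_morph).
pose N := diff_gen f E.
have E_refl x : E x x by [].
have E_sym x y : E x y -> E y x by [].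
have E_trans x y z : E x y -> E y z -> E x z by rewrite /E => ->.
have N_ideal : is_ideal N by apply: (diff_gen_ideal (r := r)).
have N_neq0 : nonzero_set N.
  apply: NNPP => N0; apply: g_ninj => x y Exy; apply: f_inj.
  apply: NNPP => fxy; apply: N0; exists (f x - f y).
  by split; [apply: diff_gen_diff | move/subr_eq0].
have E_total x y : E x y.
  have [a [b [Va [Vb xy]]]] := V_trans x y.
  pose L := actL r_lam f_morph f_gen; pose S := actS r_lam f_morph f_gen.
  have -> : y = S a (L b x) by apply: f_inj; rewrite f_actS f_actL xy.
  apply: E_sym; apply: (@E_trans _ (L b x)).
    by apply: (@actS_diff_gen X r B f) => //; apply: V_min.
  by apply: (@actL_diff_gen X r B f) => //; apply: V_min.
(* On an empty [X] the map [g] would be injective. *)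
have [x0 _] : exists x0 : X, True.
  apply: NNPP => X0; apply: g_ninj => x; by case: X0; exists x.
by exists (g x0) => y; have [x <-] := g_surj y; apply: E_total.
Qed.

(** * Orbits of an ideal *)

Section Orbits.
Variables (X : finType) (r : X * X -> X * X) (B : skew_brace) (f : X -> B).
Hypothesis r_lam : forall x, bijective (sol_lambda r x).
Hypothesis f_inj : injective f.
Hypothesis f_morph : sol_morphism r (@brace_sol B) f.
Hypothesis f_gen : forall b, add_gen (fun c => exists x, f x = c) b.
Variable I : B -> Prop.
Hypothesis idealI : is_ideal I.
Hypothesis I_diff : forall x y, I (f x - f y).
Implicit Types (a b c : B) (x y z t : X).
Local Notation "0" := (sb_zero B) : brace_scope.
Local Notation inv := (@sb_inv B).
Local Notation lam := (@sb_lambda B).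
Local Notation sig := (@sb_sigma B).
Local Notation L := (actL r_lam f_morph f_gen).
Local Notation S := (actS r_lam f_morph f_gen).

Definition same_orbit x y : Prop :=
  exists a b, [/\ I a, I b & S a (L b x) = y].

Lemma same_orbitL b x : I b -> same_orbit (L b x) x.
Proof.
move=> Ib; exists 0, (inv b); split; [exact: ideal0 | exact: idealV |].
by rewrite actS0 ?actLK.
Qed.

Lemma same_orbit_refl x : same_orbit x x.
Proof.
by exists 0, 0; split; [exact: ideal0 | exact: ideal0 | rewrite actS0 ?actL0].
Qed.

(** The maps [S a] after [L b] are closed under composition since [L d] after [S a] equals
    [S (lam d a)] after [L d]. *)
Lemma same_orbit_trans x y z :
  same_orbit x y -> same_orbit y z -> same_orbit x z.
Proof.
move=> [a [b [Ia Ib <-]]] [c [d [Ic Id <-]]].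
exists (lam d a + c), (d ** b); split; first by apply: idealD => //; apply: ideal_lam.
  exact: idealM.
by rewrite actSD ?actLM ?actL_actS.
Qed.

Lemma same_orbitS a x : I a -> same_orbit (S a x) x.
Proof.
move=> Ia; exists (- a), 0; split; [exact: idealN | exact: ideal0 |].
by rewrite actL0 ?actSK.
Qed.

Lemma same_orbit_sym x y : same_orbit x y -> same_orbit y x.
Proof.
move=> [a [b [Ia Ib <-]]].
exact: same_orbit_trans (same_orbitS _ Ia) (same_orbitL _ Ib).
Qed.

Lemma same_orbit_actL c x x' : same_orbit x x' -> same_orbit (L c x) (L c x').
Proof.
move=> [a [b [Ia Ib <-]]].
exists (lam c a), (c ** b ** inv c).
split; [exact: ideal_lam | exact: ideal_circ_conj |].
by rewrite !actLM ?actLK ?actL_actS.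
Qed.

(** Moving [S c] inwards past [S a] turns [a] into [sig c a]; moving it past [L b] turns [c] into
    [lam (inv b) c], which is [c + w] with [w] in [I]. *)
Lemma same_orbit_actS c x x' : same_orbit x x' -> same_orbit (S c x) (S c x').
Proof.
move=> [a [b [Ia Ib <-]]]; pose w := - c + lam (inv b) c.
have Iw : I w.
  by apply: ideal_subC => //; apply: ideal_lam_sub => //; apply: idealV.
have -> : S c (S a (L b x)) = S (sig c a) (L b (S w (S c x))).
  have -> : S w (S c x) = S (lam (inv b) c) x by rewrite -actSD /w ?addNKl.
  by rewrite actL_actS // lamVK -!actSD // addC_sig.
apply: same_orbit_sym; apply: same_orbit_trans (same_orbitS _ Iw).
apply: same_orbit_trans (same_orbitL _ Ib).
by apply: same_orbitS; apply: ideal_sig.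
Qed.

Lemma same_orbit_actL_base x x' y : same_orbit (L (f x) y) (L (f x') y).
Proof.
have [v Iv ->] := ideal_circ_factor idealI (I_diff x x').
by rewrite actLM //; apply/same_orbit_actL/same_orbitL.
Qed.

Lemma same_orbit_actS_base x x' y : same_orbit (S (f x) y) (S (f x') y).
Proof.
rewrite -(addNKl (f x') (f x)) actSD //.
by apply/same_orbitS/(ideal_subC idealI).
Qed.

Lemma simple_transitive :
  is_solution r -> simple_solution r -> ~ lyubashenko r ->
  forall x y, same_orbit x y.
Proof.
move=> sol_r simple_r nlyub.
have [||||orbit_eq|//] := @simple_congruence X r same_orbit sol_r simple_r.
- exact: same_orbit_refl.
- exact: same_orbit_sym.
- exact: same_orbit_trans.
- apply: (solution_congr_of_act (r_lam := r_lam) (f_morph := f_morph)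
    (f_gen := f_gen) f_inj same_orbit_refl same_orbit_sym same_orbit_trans) => *.
  + exact: same_orbit_actL.
  + exact: same_orbit_actS.
  + exact: same_orbit_actL_base.
  + exact: same_orbit_actS_base.
(* In the remaining case orbits are single points, so maps attached to different base points
   coincide and [r] is Lyubashenko. *)
have L_eq x y t : L (f x) t = L (f y) t.
  exact/orbit_eq/same_orbit_actL_base.
have S_eq x y t : S (f x) t = S (f y) t.
  exact/orbit_eq/same_orbit_actS_base.
have LV_eq x y t : L (inv (f x)) t = L (inv (f y)) t.
  rewrite -{1}(actLVK r_lam f_inj f_morph f_gen (f y) t) (L_eq y x).
  exact: actLK.
case: nlyub => x y z; rewrite /sol_lambda /sol_rho.
rewrite !(solution_lam r_lam f_inj f_morph f_gen).
rewrite !(solution_rho r_lam f_inj f_morph f_gen); split=> //.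
by rewrite (S_eq _ (L (f z) y)); apply: LV_eq.
Qed.

End Orbits.

(** * Descent to a brace in which no non-zero ideal separates the points *)

Lemma brace_of_simple (X : finType) (r : X * X -> X * X)
    (B : skew_brace) (f : X -> B) :
  is_solution r -> nondegenerate r -> ~ lyubashenko r -> simple_solution r ->
  injective f -> sol_morphism r (@brace_sol B) f ->
  (forall b, add_gen (fun c => exists x, f x = c) b) ->
  exists (B : skew_brace) (f : X -> B),
    injective f /\ sol_morphism r (@brace_sol B) f /\
    (forall b : B, add_gen (fun c => exists x, f x = c) b) /\
    (let V := ideal_gen (fun c => exists x y, c = sb_add (f x) (sb_opp (f y))) in
     nonzero_set V /\
     (forall I, is_ideal I -> nonzero_set I -> forall b, V b -> I b) /\
     (forall a b, V a -> V b -> forall x, exists y,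
         sb_sigma a (sb_lambda b (f x)) = f y) /\
     (forall x y, exists a b,
         V a /\ V b /\ sb_sigma a (sb_lambda b (f x)) = f y)).
Proof.
move=> sol_r nd_r nlyub simple_r; have [_ [r_lam _]] := nd_r.
have [n] := ubnP #|B|; elim: n B f => // n IHn B f ltBn f_inj f_morph f_gen.
case: (classic (exists2 I : B -> Prop, is_ideal I /\ nonzero_set I &
                  forall x y, I (f x - f y) -> x = y)) => [|no_I].
  case=> I [idealI [b [Ib b_neq0]]] I_inj.
  have [Q [p [p_surj pD pM pE]]] := quotient_brace idealI.
  have pf_inj : injective (p \o f) by move=> x y /pE/I_inj.
  apply: (IHn Q (p \o f)) pf_inj _ _.
  (* The quotient is strictly smaller, as [p] identifies the non-zero [b] with zero. *)
  - have codom_p : #|codom p| = #|Q|.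
      by apply: eq_card => q; have [a <-] := p_surj q; rewrite codom_f.
    rewrite ltnS in ltBn; apply: leq_trans ltBn; rewrite ltn_neqAle -codom_p.
    rewrite leq_image_card andbT; apply/negP => /image_injP p_inj.
    by apply: b_neq0; apply: p_inj => //; apply/pE; rewrite oppr0 addr0.
  - move=> x y; rewrite /comp -brace_sol_morph // -f_morph //.
  - move=> q; have [a <-] := p_surj q.
    elim: (f_gen a) => [_ [x <-] | | c d _ IHc _ IHd | c _ IHc].
    + by apply: add_gen_base; exists x.
    + by rewrite brace_morph0 //; apply: add_gen_zero.
    + by rewrite pD; apply: add_gen_add.
    + by rewrite brace_morphN //; apply: add_gen_opp.
exists B, f; split=> //; split=> //; split=> //=.
set V := ideal_gen _.
have V_ideal : is_ideal V by apply: ideal_gen_ideal.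
have V_diff x y : V (f x - f y) by move=> I _; apply; exists x, y.
split; last split; last split.
- have [/card_gt1P [x [y [_ _ /eqP xy]]] _] := simple_r.
  by exists (f x - f y); split=> // /subr_eq0/f_inj.
- move=> I idealI I_neq0 b; apply=> // _ [x [y ->]].
  have [Q [p [_ pD pM pE]]] := quotient_brace idealI.
  have pf_morph : sol_morphism r (@brace_sol Q) (p \o f).
    by move=> u v; rewrite /comp -brace_sol_morph // -f_morph.
  apply/pE; have [pf_inj|pf_const] := simple_morphism sol_r simple_r pf_morph.
    by case: no_I; exists I => // u v /pE/pf_inj.
  exact: pf_const.
- move=> a b _ _ x.
  exists (actS r_lam f_morph f_gen a (actL r_lam f_morph f_gen b x)).
  by rewrite f_actS f_actL.
move=> x y.
have [a [b [Va Vb <-]]] := simple_transitive r_lam f_inj f_morph f_gen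
  V_ideal V_diff sol_r simple_r nlyub x y.
by exists a, b; rewrite f_actS f_actL.
Qed.

(** * The finite skew brace of a solution *)

Section GroupBrace.
Variables (gT : finGroupType) (l : gT -> gT -> gT).
Hypothesis l_morph : forall a, {morph l a : b c / (b * c)%g}.
Hypothesis l_inj : forall a, injective (l a).
Hypothesis l_cocycle : forall a b c, l (a * l a b)%g c = l a (l b c).

Lemma group_brace_l1r a : l a 1%g = 1%g.
Proof. by apply: (mulgI (l a 1%g)); rewrite -l_morph !mulg1. Qed.

Lemma group_brace_l1 a : l 1%g a = a.
Proof.
by apply: (@l_inj 1%g); rewrite -l_cocycle group_brace_l1r mulg1.
Qed.

Let circ a b := (a * l a b)%g.
Let cinv a := finv (l a) a^-1%g.

Lemma group_brace_circA a b c : circ a (circ b c) = circ (circ a b) c.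
Proof. by rewrite /circ l_morph l_cocycle mulgA. Qed.

Lemma group_brace_circ1 a : circ 1%g a = a.
Proof. by rewrite /circ mul1g group_brace_l1. Qed.

Lemma group_brace_circV a : circ (cinv a) a = 1%g.
Proof.
have cinvE : l a (cinv a) = a^-1%g by apply: (f_finv (@l_inj a)).
apply: (@l_inj a); rewrite /circ l_morph -l_cocycle cinvE mulgV.
by rewrite group_brace_l1 group_brace_l1r mulVg.
Qed.

Lemma group_brace_compat a b c :
  circ a (b * c)%g = (circ a b * a^-1 * circ a c)%g.
Proof. by rewrite /circ l_morph !mulgA mulgKV. Qed.

(** A skew brace with prescribed additive group is a family [l] of automorphisms satisfying
    [l_cocycle]; [l] becomes its lambda map. *)
Definition group_brace : skew_brace :=
  SkewBrace (@mulgA gT) (@mul1g gT) (@mulVg gT) group_brace_circA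
    group_brace_circ1 group_brace_circV group_brace_compat.

Lemma group_brace_lam (a b : group_brace) : sb_lambda a b = l a b.
Proof. exact: mulKg. Qed.

Lemma group_brace_sig (a b : group_brace) :
  sb_sigma a b = ((b : gT) ^ (a : gT))%g.
Proof. by rewrite /conjg mulgA. Qed.

End GroupBrace.

(** In a finite group the generated subgroup consists of products of generators, so there is no
    clause for inverses. *)
Lemma gen_ind (gT : finGroupType) (A : {set gT}) (P : gT -> Prop) :
  P 1%g -> (forall a, a \in A -> P a) ->
  (forall a b, a \in <<A>>%g -> b \in <<A>>%g -> P a -> P b -> P (a * b)%g) ->
  forall a, a \in <<A>>%g -> P a.
Proof.
move=> P1 PA PM _ /gen_prodgP [n [c cA ->]].
suff [] : (\prod_(i < n) c i)%g \in <<A>>%g /\ P (\prod_(i < n) c i)%g by [].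
apply: (big_ind (fun a => a \in <<A>>%g /\ P a)); first by split.
  by move=> a b [aA Pa] [bA Pb]; split; [apply: groupM | apply: PM].
by move=> i _; split; [apply: mem_gen | apply: PA].
Qed.

(** * The derived rack of a solution *)

Section PermutationBrace.
Variables (X : finType) (r : X * X -> X * X).
Hypothesis sol_r : is_solution r.
Hypothesis nd_r : nondegenerate r.
Implicit Types (x y z t u v : X) (p q : {perm X}).

Local Notation h := (sol_rho r).

Lemma r_inj : injective r. Proof. by have [/bij_inj] := nd_r. Qed.

Lemma lam_perm_subproof x : injective (sol_lambda r x).
Proof. by have [_ [/(_ x)/bij_inj]] := nd_r. Qed.

Lemma rho_inj y : injective (h y).
Proof. by have [_ [_ /(_ y)/bij_inj]] := nd_r. Qed.

Definition lam_perm x : {perm X} := perm (@lam_perm_subproof x).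
Local Notation l := lam_perm.

Lemma solE x y : r (x, y) = (l x y, h y x).
Proof. by rewrite permE [LHS]surjective_pairing. Qed.

Lemma yang_baxter x y z :
  [/\ l x (l y z) = l (l x y) (l (h y x) z),
      h (l (h y x) z) (l x y) = l (h (l y z) x) (h z y) &
      h z (h y x) = h (h z y) (h (l y z) x)].
Proof.
by have := sol_r (x, y, z); rewrite /r12 /r23 !solE => -[-> -> ->].
Qed.

(* The rack operation of the derived solution. *)
Definition rack y x : X := l y (h ((l x)^-1%g y) x).

Lemma rackE x y : rack (l x y) x = l (l x y) (h y x).
Proof. by rewrite /rack permK. Qed.

(** Writing [y = l x t] opens the rack operation by [rackE]; the claim then follows from the braid
    relation at [(a, x, t)] and at [(a, l x t, h t x)]. *)
Lemma lam_rack a y x : l a (rack y x) = rack (l a y) (l a x).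
Proof.
rewrite -(permKV (l x) y); set t := (l x)^-1%g y.
have [Y1 Y2 _] := yang_baxter a x t; rewrite rackE Y1 rackE -Y1 Y2.
by have [-> _ _] := yang_baxter a (l x t) (h t x).
Qed.

Lemma rackD z y x : rack z (rack y x) = rack (rack z y) (rack z x).
Proof.
(* In the coordinates [y = l x t], [z = l x (l t s)] both sides become [l z (rack (l p q) p)]. *)
rewrite -(permKV (l x) y); set t := (l x)^-1%g y.
rewrite -(permKV (l x) z) -(permKV (l t) ((l x)^-1%g z)).
set s := (l t)^-1%g _; set p := h (l t s) x; set q := h s t.
have [Y1 Y2 Y3] := yang_baxter x t s.
have [Z1 _ _] := yang_baxter (l x t) (l (h t x) s) (h s (h t x)).
have [W1 _ _] := yang_baxter x (l t s) q.
transitivity (l (l x (l t s)) (rack (l p q) p)).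
  by rewrite rackE {1}Y1 -lam_rack rackE Z1 -Y1 Y2 Y3 -rackE.
by rewrite -[rack _ (l x t)]lam_rack [rack _ t]rackE W1 [rack _ x]rackE lam_rack.
Qed.

(** If [rack y] agrees at [x] and [x'], then [r] agrees at the pairs completing [x] and [x'] to
    first output [y]. *)
Lemma rack_inj y : injective (rack y).
Proof.
move=> x x' /perm_inj eq_h.
suff /r_inj[] : r (x, (l x)^-1%g y) = r (x', (l x')^-1%g y) by [].
by rewrite !solE !permKV eq_h.
Qed.

(* Both [u] and [v] are sent by [h w] to [rack w w]. *)
Lemma lam_fixed u v w : l u w = u -> l v w = v -> u = v.
Proof.
move=> uw vw; apply: (@rho_inj w).
suff hw t : l t w = t -> h w t = rack w w by rewrite !hw.
by move=> tw; apply: (@perm_inj _ (l t)); rewrite lam_rack tw -{3}tw rackE tw.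
Qed.


(** * Rack automorphisms and the permutations attached to points *)

Definition rack_perm y : {perm X} := perm (@rack_inj y).

Definition rack_aut : {set {perm X}} :=
  [set p : {perm X} | [forall x, forall y, p (rack y x) == rack (p y) (p x)]].

Lemma rack_autP p :
  reflect (forall y x, p (rack y x) = rack (p y) (p x)) (p \in rack_aut).
Proof.
rewrite inE; apply: (iffP 'forall_forallP) => aut_p; last by move=> x y; apply/eqP.
by move=> y x; apply/eqP.
Qed.

Lemma rack_aut_group : group_set rack_aut.
Proof.
apply/group_setP; split=> [|p q /rack_autP aut_p /rack_autP aut_q].
  by apply/rack_autP => y x; rewrite !perm1.
by apply/rack_autP => y x; rewrite !permM aut_p aut_q.
Qed.
Canonical rack_aut_groupType := Group rack_aut_group.

Lemma lam_aut x : l x \in rack_aut.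
Proof. by apply/rack_autP => y z; rewrite lam_rack. Qed.

(* Permutations of [X] record the value of [lam]: adding the generator [x] to an
   element acting as [p] gives an element acting as [l (p^-1 x)] then [p]. *)
Definition shift x p : {perm X} :=
  if p \in rack_aut then (l (p^-1%g x) * p)%g else p.

Lemma shift_aut x p : (shift x p \in rack_aut) = (p \in rack_aut).
Proof.
by rewrite /shift; case: ifP => // aut_p; rewrite groupMl ?aut_p ?lam_aut.
Qed.

Lemma shift_inj x : injective (shift x).
Proof.
move=> p q eq_pq; have := shift_aut x p; rewrite eq_pq shift_aut => aut_qp.
move: eq_pq; rewrite /shift aut_qp; case: ifP => // _.
set u := (p^-1)%g x; set v := (q^-1)%g x; move=> eq_pq.
suff uv : u = v by move: eq_pq; rewrite uv; apply: mulgI.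
(* Products of permutations act from left to right, so [p (l u w) = x] gives [l u w = u], and
   likewise [l v w = v]; then [lam_fixed] applies. *)
pose w := (l u * p)^-1%g x.
apply: (@lam_fixed _ _ w).
  by apply: (@perm_inj _ p); rewrite -permM !permKV.
by apply: (@perm_inj _ q); rewrite -permM /w eq_pq !permKV.
Qed.

Definition shift_perm x : {perm {perm X}} := perm (@shift_inj x).

Notation gT := ({perm {perm X}} * {perm X})%type.

(** The first component remembers [l x], the second the rack action; together they determine the
    solution. *)
Definition emb x : gT := (shift_perm x, rack_perm x).

Definition right_mul p : {perm {perm X}} := perm (mulIg p).

Definition twist p : gT := (right_mul p, p).

Lemma twistM p q : twist (p * q)%g = (twist p * twist q)%g.
Proof.
by congr pair; apply/permP => s; rewrite permM !permE /= mulgA.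
Qed.

Definition lam_of (a : gT) : {perm X} := a.1 1%g.

(** Since [p = right_mul p 1], the conjugate of [b.1] sends [p] to [b.1 1] times [p]. This is the
    source of the cocycle identity. *)
Lemma lam_ofM (a b : gT) :
  lam_of (a * b ^ twist (lam_of a))%g = (lam_of b * lam_of a)%g.
Proof.
rewrite /lam_of; set p := a.1 1%g.
have -> : (a * b ^ twist p)%g.1 = (a.1 * b.1 ^ right_mul p)%g by [].
rewrite permM -/p; have {2}-> : p = right_mul p 1%g by rewrite permE mul1g.
by rewrite permJ permE.
Qed.

Lemma conj_twist_comp (a b c : gT) :
  (c ^ twist (lam_of (a * b ^ twist (lam_of a))) =
   (c ^ twist (lam_of b)) ^ twist (lam_of a))%g.
Proof. by rewrite lam_ofM twistM conjgM. Qed.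

Lemma lam_of_emb x : lam_of (emb x) = l x.
Proof. by rewrite /lam_of permE /shift group1 invg1 perm1 mulg1. Qed.

(** On the first component, conjugation replaces [q] by [q * p], whose inverse sends [p x] to
    [q^-1 x]; on the second it is the automorphism property of [p]. *)
Lemma emb_twist x p : p \in rack_aut -> (emb x ^ twist p)%g = emb (p x).
Proof.
move=> aut_p.
have -> : (emb x ^ twist p)%g = ((shift_perm x ^ right_mul p)%g,
                                 (rack_perm x ^ p)%g) by [].
congr pair; apply/permP => s.
  rewrite -(permKV (right_mul p) s) permJ !permE /shift.
  set q := (right_mul p)^-1%g s; rewrite groupMr //.
  by case: ifP => // _; rewrite invMg permM permK mulgA.
by rewrite -(permKV p s) permJ !permE; move/rack_autP: aut_p => ->.
Qed.

(** The second component is self-distributivity. The first, at an automorphism [s], is the braid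
    relation for the points [s^-1 x] and [s^-1 z]. *)
Lemma emb_rack x z : (emb x ^ emb z)%g = emb (rack z x).
Proof.
apply: (mulgI (emb z)); rewrite -conjgC.
congr pair; apply/permP => s; rewrite !permM !permE; last exact: rackD.
rewrite /shift; case: (boolP (s \in rack_aut)) => [aut_s|/negbTE -> //].
have lsaut u : (l u * s)%g \in rack_aut by rewrite groupMl ?lam_aut.
rewrite !lsaut !mulgA; congr (_ * _)%g; apply/permP => t.
rewrite !invMg !permM.
have aut_sV : (s^-1)%g \in rack_aut by rewrite groupV.
move/rack_autP: aut_sV => ->; set u := (s^-1)%g x; set v := (s^-1)%g z.
have [-> _ _] := yang_baxter u ((l u)^-1%g v) t.
by rewrite permKV /rack permK.
Qed.

(** * The skew brace on the group generated by the points *)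

Definition emb_group := <<[set emb x | x : X]>>%G.

Lemma emb_in x : emb x \in emb_group.
Proof. by apply: mem_gen; apply/imsetP; exists x. Qed.

(** Shifts preserve [rack_aut], hence so does the first component of every element of the generated
    group; evaluate it at the identity. *)
Lemma lam_of_aut a : a \in emb_group -> lam_of a \in rack_aut.
Proof.
suff stab : forall b : gT, b \in emb_group ->
    forall p, p \in rack_aut -> b.1 p \in rack_aut.
  by move=> aG; apply: stab => //; apply: group1.
apply: gen_ind => [p|_ /imsetP[x _ ->] p aut_p|b c _ _ IHb IHc p aut_p].
- by rewrite perm1.
- by rewrite permE shift_aut.
- by rewrite permM; apply/IHc/IHb.
Qed.

Lemma emb_group_twist p b :
  p \in rack_aut -> b \in emb_group -> (b ^ twist p)%g \in emb_group.
Proof.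
move=> aut_p; elim/gen_ind: b / => [|_ /imsetP[x _ ->]|b c _ _ IHb IHc].
- by rewrite conj1g group1.
- by rewrite emb_twist // emb_in.
- by rewrite conjMg groupM.
Qed.

(** [subg] would return the identity outside [emb_group]; [sgval_lG] shows that this default does
    not occur. *)
Let lG (a b : [subg emb_group]) : [subg emb_group] :=
  subg emb_group (sgval b ^ twist (lam_of (sgval a)))%g.

Lemma sgval_lG a b : sgval (lG a b) = (sgval b ^ twist (lam_of (sgval a)))%g.
Proof. by rewrite subgK // emb_group_twist ?lam_of_aut ?subgP. Qed.

Lemma lG_morph a : {morph lG a : b c / (b * c)%g}.
Proof. by move=> b c; apply: val_inj; rewrite /= !sgval_lG /= conjMg. Qed.

Lemma lG_inj a : injective (lG a).
Proof.
move=> b c /(congr1 sgval); rewrite !sgval_lG => /conjg_inj.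
exact: val_inj.
Qed.

Lemma lG_cocycle a b c : lG (a * lG a b)%g c = lG a (lG b c).
Proof.
by apply: val_inj; rewrite /= !sgval_lG /= sgval_lG conj_twist_comp.
Qed.

Definition perm_brace := group_brace lG_morph lG_inj lG_cocycle.

Definition perm_brace_gen x : perm_brace := subg emb_group (emb x).

Lemma sgval_gen x : sgval (perm_brace_gen x) = emb x.
Proof. by rewrite subgK ?emb_in. Qed.

Lemma gen_lam x y :
  sb_lambda (perm_brace_gen x) (perm_brace_gen y) = perm_brace_gen (l x y).
Proof.
apply: val_inj; rewrite group_brace_lam /= sgval_lG !sgval_gen lam_of_emb.
by rewrite emb_twist ?lam_aut.
Qed.

Lemma gen_sig z x :
  sb_sigma (perm_brace_gen z) (perm_brace_gen x) = perm_brace_gen (rack z x).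
Proof.
apply: val_inj; rewrite group_brace_sig /= !sgval_gen -emb_rack.
by rewrite /conjg /= !mulgA.
Qed.

Lemma gen_morph : sol_morphism r (@brace_sol perm_brace) perm_brace_gen.
Proof.
move=> x y; rewrite [RHS]surjective_pairing brace_sol2 brace_sol1 solE.
rewrite !gen_lam gen_sig rackE; congr pair.
by rewrite -(gen_lam (l x y)) lamK.
Qed.

Lemma gen_generates (b : perm_brace) :
  add_gen (fun c => exists x, perm_brace_gen x = c) b.
Proof.
suff gen a : a \in emb_group ->
    add_gen (fun c => exists x, perm_brace_gen x = c)
      (subg emb_group a : perm_brace).
  by rewrite -(sgvalK b); apply: gen; apply: subgP.
elim/gen_ind: a / => [|_ /imsetP[x _ ->]|a c aG cG IHa IHc].
- have -> : subg emb_group 1%g = sb_zero perm_brace.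
    by apply: val_inj; rewrite /= subgK ?group1.
  exact: add_gen_zero.
- by apply: add_gen_base; exists x.
- have -> : subg emb_group (a * c)%g =
            (subg emb_group a : perm_brace) + subg emb_group c.
    by apply: val_inj; rewrite /= !subgK ?groupM.
  exact: add_gen_add.
Qed.

Lemma gen_const_lyubashenko :
  (forall x y, perm_brace_gen x = perm_brace_gen y) -> lyubashenko r.
Proof.
move=> gen_const.
have emb_const x y : emb x = emb y by rewrite -!sgval_gen (gen_const x y).
have l_const x y : l x = l y by rewrite -!lam_of_emb (emb_const x y).
have rack_const x y t : rack x t = rack y t.
  by have [_ /permP/(_ t)] := emb_const x y; rewrite !permE.
move=> x y z; split.
  by have /permP/(_ z) := l_const x y; rewrite !permE.
(* By [rackE], the value of [h] is recovered from the rack and from [l], both independent of the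
   base point. *)
apply: (@perm_inj _ (l (l z x))); rewrite -rackE.
by rewrite (l_const (l z x) (l z y)) -rackE; apply: rack_const.
Qed.

End PermutationBrace.

Theorem theorem3p3 (X : finType) (r : X * X -> X * X) :
  is_solution r -> nondegenerate r -> ~ lyubashenko r ->
  (simple_solution r <->
   exists (B : skew_brace) (f : X -> B),
     injective f /\ sol_morphism r (@brace_sol B) f /\
     (* B is additively generated by X *)
     (forall b : B, add_gen (fun c => exists x, f x = c) b) /\
     (let V := ideal_gen (fun c => exists x y, c = sb_add (f x) (sb_opp (f y))) in
      (* V is the smallest non-zero ideal of B *)
      nonzero_set V /\
      (forall I, is_ideal I -> nonzero_set I -> forall b, V b -> I b) /\
      (* X is invariant under sigma_a lambda_b for a, b in V *)
      (forall a b, V a -> V b -> forall x, exists y,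
          sb_sigma a (sb_lambda b (f x)) = f y) /\
      (* {sigma_a lambda_b |_X : a, b in V} acts transitively on X *)
      (forall x y, exists a b, V a /\ V b /\ sb_sigma a (sb_lambda b (f x)) = f y))).
Proof.
move=> sol_r nd_r nlyub; split=> [simple_r|].
  apply: (brace_of_simple (f := perm_brace_gen sol_r nd_r)) => //.
  - have [//|gen_const] :=
      simple_morphism sol_r simple_r (gen_morph sol_r nd_r).
    by case: nlyub; apply: gen_const_lyubashenko gen_const.
  - exact: gen_morph.
  - exact: gen_generates.
case=> B [f [f_inj [f_morph [f_gen [V_neq0 [V_min [_ V_trans]]]]]]].
exact: simple_of_smallest_ideal f_gen V_neq0 V_min V_trans.
Qed.
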